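(* For every integer $n\ge 1$, the number of two-ball spherical siteswap sequences $t_1t_2\ldots t_n$ of length $n$ with a throw made at each time step (i.e. $t_i\ge 1$ for all $i$) equals $a_2(n)$, the number of necklaces on $n$ black and white beads such that (i) there is at least one black bead; (ii) between any two (cyclically consecutive) black beads there is an even number of white beads; and (iii) rotations and flippings of necklaces are considered distinct. Moreover, with $a_2(0)=0$ and $a_2(1)=1$, these numbers satisfy $$a_2(n)=a_2(n-1)+a_2(n-2)+1-(-1)^n\qquad (n\ge 2),$$ i.e. they are the associated Mersenne numbers.
   Context: A siteswap sequence of length (period) $n$ is a sequence $t_1t_2\ldots t_n$ of nonnegative integers such that the residues $i+t_i \pmod n$, $1\le i\le n$, are pairwise distinct. Its number of balls is the integer $(t_1+\cdots+t_n)/n$; thus a two-ball siteswap sequence has $t_1+\cdots+t_n=2n$. A spherical siteswap sequence of length $n$ is a siteswap sequence $t_1t_2\ldots t_n$ for which, in addition, the values $i+(t_i/2) \pmod n$ (rational numbers taken modulo $n$), over those $i$ with $t_i\ne 0$, are pairwise distinct. Rotations of a sequence are considered distinct, and sequences of length $n$ are counted whether or not $n$ is their minimal period. A necklace on $n$ beads is a coloring, black or white, of the $n$ labelled positions $1,\ldots,n$ arranged cyclically. Condition (ii) is read cyclically: for each black bead, the number of white beads strictly between it and the next black bead clockwise must be even; if there is exactly one black bead, there are $n-1$ white beads between it and itself, so $n-1$ must be even. The associated Mersenne numbers are the sequence $0,1,1,4,5,11,16,29,45,76,\ldots$ (OEIS A001350) determined by the initial values $0,1$ (indices $0,1$) and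 the displayed recurrence. *)

(* Defs.v *)
From mathcomp Require Import all_boot all_order all_algebra.
From mathcomp Require Import classical_sets functions cardinality.

Set Implicit Arguments.
Unset Strict Implicit.
Unset Printing Implicit Defensive.

Import GRing.Theory.

(* Positions are numbered 0, ..., n-1 rather than 1, ..., n; this translates
   all the values i + t_i and i + t_i / 2 by 1, so it does not affect whether
   they are pairwise distinct modulo n. *)

Definition siteswap (n : nat) (t : {ffun 'I_n -> nat}) : Prop :=
  forall i j : 'I_n, i + t i = j + t j %[mod n] -> i = j.

Local Open Scope ring_scope.

Definition num_balls (n : nat) (t : {ffun 'I_n -> nat}) : rat :=
  (\sum_(i < n) t i)%N%:R / n%:R.

Definition eq_ratmod (n : nat) (x y : rat) : Prop :=
  exists k : int, x - y = k%:~R * n%:R.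

Definition spherical_siteswap (n : nat) (t : {ffun 'I_n -> nat}) : Prop :=
  siteswap t /\
  forall i j : 'I_n, t i <> 0%N -> t j <> 0%N ->
    eq_ratmod n (i%:R + (t i)%:R / 2%:R) (j%:R + (t j)%:R / 2%:R) -> i = j.

Local Close Scope ring_scope.

(* A necklace is a coloring c of the labelled positions, true being black.
   Clockwise means along ordS, the cyclic successor.  The relation below holds
   when i is black, the next k beads are white, and the bead after them is
   black; that last bead is i itself when i is the only black bead, k = n-1. *)
Definition black_gap (n : nat) (c : {ffun 'I_n -> bool}) (i : 'I_n) (k : nat) :
    bool :=
  [&& c i, [forall j : 'I_k, ~~ c (iter j.+1 (@ordS n) i)]
    & c (iter k.+1 (@ordS n) i)].

(* Ranging over k < n loses nothing: going once around returns to i. *)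
Definition even_gaps (n : nat) (c : {ffun 'I_n -> bool}) : bool :=
  [forall i : 'I_n, forall k : 'I_n, black_gap c i k ==> ~~ odd k].

Definition a2 (n : nat) : nat :=
  #|[set c : {ffun 'I_n -> bool} | [exists i, c i] && even_gaps c]|.

Local Open Scope ring_scope.

Fixpoint assoc_mersenne (n : nat) : int :=
  match n with
  | 0 => 0
  | 1 => 1
  | (m.+1 as p).+1 => assoc_mersenne p + assoc_mersenne m + 1 - (-1) ^+ m.+2
  end.

(* Main.v *)
Require Import Defs.
From mathcomp Require Import all_boot all_order all_algebra.
From mathcomp Require Import classical_sets functions cardinality.
From mathcomp Require Import zify lra.

Set Implicit Arguments.
Unset Strict Implicit.
Unset Printing Implicit Defensive.

(** Subtracting 1 from every throw turns a two-ball siteswap with t_i >= 1 into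
    a one-ball siteswap u.  The number of arcs [i, i + u_i) over a given beat
    does not depend on the beat, and it averages to sum u / n = 1; hence the
    arcs tile the circle, and u is determined by its support, the black beads:
    each nonzero u_i is the distance to the next black bead.  An arc of even
    length has a white bead at its midpoint, which violates the spherical
    condition, while arcs of odd length have distinct midpoints.

    Recording at each bead the parity of the number of white beads up to the
    next black one identifies the necklaces of [a2 n] with the closed walks of
    length n on the golden-mean graph (two odd states are never adjacent) that
    are not alternating.  The former are counted by a Fibonacci recurrence, and
    there are 1 + (-1)^n alternating ones. *)

(** * Cyclic shifts and covering multiplicities of arcs *)

Section Cyclic.
Variable n : nat.
Implicit Types (i j x : 'I_n) (u : 'I_n -> nat) (c : 'I_n -> bool).

Definition shift k i : 'I_n := iter k (@ordS n) i.

Lemma shiftD k l i : shift (k + l) i = shift k (shift l i).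
Proof. exact: iterD. Qed.

Lemma shiftS k i : shift k.+1 i = ordS (shift k i).
Proof. by []. Qed.

Lemma shiftSr k i : shift k.+1 i = shift k (ordS i).
Proof. exact: iterSr. Qed.

Lemma shift_inj k : injective (shift k).
Proof. by elim: k => [|k IHk] i j //= /ordS_inj /IHk. Qed.

Lemma val_shift k i : shift k i = (i + k) %% n :> nat.
Proof.
elim: k => [|k IHk] /=; first by rewrite addn0 modn_small.
by rewrite IHk -addn1 modnDml addn1 addnS.
Qed.

Lemma shift_eq k l i j : i + k = j + l %[mod n] <-> shift k i = shift l j.
Proof.
split=> [E|/(congr1 val)]; last by rewrite /= !val_shift.
by apply/val_inj; rewrite /= !val_shift.
Qed.

Lemma shift_surj i j : exists2 k, k < n & shift k i = j.
Proof.
have n0 : 0 < n by case: n i => [[]|].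
exists ((j + (n - i)) %% n); first by rewrite ltn_mod.
apply/val_inj; rewrite /= val_shift modnDmr addnCA subnKC; last exact: ltnW.
by rewrite modnDr modn_small.
Qed.

(** Arcs are counted with multiplicity: a pair (i, k) with k < u_i is one visit to [x], so an arc
    longer than n may meet [x] several times. *)
Definition covers u x : nat :=
  #|[pred p : {i : 'I_n & 'I_(u i)} | shift (tagged p) (tag p) == x]|.

Lemma coversE u x :
  covers u x = \sum_(i < n) \sum_(k < u i) (shift k i == x).
Proof.
rewrite /covers -sum1_card (eq_bigr (fun i =>
  \sum_(k < u i | shift k i == x) 1)) => [|i _].
  apply/esym/(@sig_big_dep _ _ _ _ (fun i => 'I_(u i)) predT
    (fun i k => shift k i == x) (fun _ _ => 1)).
by rewrite [RHS]big_mkcond; apply: eq_bigr => k _; case: eqP.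
Qed.

Lemma sum_covers u : \sum_x covers u x = \sum_i u i.
Proof.
under eq_bigr do rewrite coversE.
rewrite exchange_big; apply: eq_bigr => i _; rewrite exchange_big /=.
rewrite (eq_bigr (fun=> 1)) => [|k _]; first by rewrite sum1_card card_ord.
by rewrite (bigD1 (shift k i)) //= eqxx big1 // => x /negPf; rewrite eq_sym => ->.
Qed.

Lemma sum_eq_inj (f : 'I_n -> 'I_n) x :
  injective f -> \sum_i (f i == x : nat) = 1.
Proof.
move=> injf; have [g fK gK] := injF_bij injf.
rewrite (bigD1 (g x)) //= gK eqxx big1 ?addn0 // => i ni.
by case: eqP => // E; rewrite -E fK eqxx in ni.
Qed.

(* Count the pairs (i, k) with k <= u i and i + k = x + 1, isolating either the
   last k or the first one. *)
Lemma covers_ordS u x : injective (fun i => shift (u i) i) ->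
  covers u (ordS x) = covers u x.
Proof.
move=> inju; apply/eqP; rewrite -(eqn_add2r 1).
rewrite -{1}(sum_eq_inj (ordS x) inju) coversE -big_split /=.
rewrite (eq_bigr (fun i => \sum_(k < (u i).+1) (shift k i == ordS x))); last first.
  by move=> i _; rewrite big_ord_recr.
rewrite (eq_bigr (fun i => (i == ordS x) + \sum_(k < u i) (shift k i == x))).
  by rewrite big_split /= (@sum_eq_inj id) // -coversE addnC.
move=> i _; rewrite big_ord_recl; congr (_ + _).
by apply: eq_bigr => k _; rewrite (inj_eq (@ordS_inj n)).
Qed.

Lemma covers_const u x y : injective (fun i => shift (u i) i) ->
  covers u x = covers u y.
Proof.
move=> inju; have [k _ <-] := shift_surj x y.
by elim: k => //= k ->; rewrite covers_ordS.
Qed.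

(** Double counting of the visits: by arc they number sum u, by beat n times the common
    multiplicity. *)
Lemma sum_covers_const u x : injective (fun i => shift (u i) i) ->
  \sum_i u i = n * covers u x.
Proof.
move=> inju; rewrite -sum_covers (eq_bigr (fun=> covers u x)) => [|y _].
  by rewrite big_const_ord iter_addn_0 mulnC.
exact: covers_const.
Qed.

Lemma covers_le1P u x : covers u x <= 1 <->
  (forall i j k l, k < u i -> l < u j -> shift k i = x -> shift l j = x ->
     i = j /\ k = l).
Proof.
rewrite /covers; split=> [/card_le1_eqP le1 i j k l ki lj Ei Ej|uniq].
  have := le1 (Tagged _ (Ordinal ki)) (Tagged _ (Ordinal lj)).
  rewrite !inE /= Ei Ej eqxx => /(_ isT isT) E.
  split; first exact: esym (congr1 tag E).
  exact: esym (congr1 (fun p : {i : 'I_n & 'I_(u i)} => tagged p : nat) E).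
apply/card_le1_eqP => -[i k] [j l]; rewrite !inE /= => /eqP Ei /eqP Ej.
have [E F] := uniq _ _ _ _ (ltn_ord k) (ltn_ord l) Ei Ej.
by subst j; rewrite (val_inj F : k = l).
Qed.

(** * One-ball siteswaps as tilings of the circle *)

Definition one_ball u :=
  injective (fun i => shift (u i) i) /\ \sum_i u i = n.

(** The constant multiplicity is sum u / n = 1, so no beat is visited twice. *)
Lemma one_ball_cover u i j k l : one_ball u -> k < u i -> l < u j ->
  shift k i = shift l j -> i = j /\ k = l.
Proof.
move=> [inju sumu] ki lj E.
have n0 : 0 < n := leq_ltn_trans (leq0n i) (ltn_ord i).
have /covers_le1P : covers u (shift l j) <= 1.
  have := sum_covers_const (shift l j) inju.
  by rewrite sumu -{1}[n]muln1 => /eqP; rewrite eqn_pmul2l // => /eqP <-.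
by move=> /(_ i j k l ki lj E erefl).
Qed.

(** * The distance to the next black bead *)

(* Junk value n when no bead is black. *)
Definition dist_black c i := find (fun k => c (shift k i)) (iota 0 n).

Lemma dist_black_lt c i : [exists j, c j] -> dist_black c i < n.
Proof.
case/existsP=> j cj; rewrite -[X in _ < X](size_iota 0) -has_find.
have [k kn E] := shift_surj i j.
by apply/hasP; exists k; rewrite ?mem_iota ?E.
Qed.

Lemma dist_black_hit c i : [exists j, c j] -> c (shift (dist_black c i) i).
Proof.
move=> ex; have lt := dist_black_lt i ex.
have := @nth_find _ 0 (fun k => c (shift k i)) (iota 0 n).
by rewrite has_find size_iota nth_iota // => ->.
Qed.

Lemma dist_black_min c i k : k < dist_black c i -> ~~ c (shift k i).
Proof.
move=> lt; have := before_find 0 lt; rewrite nth_iota ?add0n; first by move=> ->.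
by apply: leq_trans lt _; rewrite -[X in _ <= X](size_iota 0 n) find_size.
Qed.

Lemma dist_blackE c i m : c (shift m i) ->
  (forall k, k < m -> ~~ c (shift k i)) -> dist_black c i = m.
Proof.
move=> cm minm.
have ex : [exists j, c j] by apply/existsP; exists (shift m i).
case: (ltngtP (dist_black c i) m) => // lt.
  by have := minm _ lt; rewrite dist_black_hit.
by have := dist_black_min lt; rewrite cm.
Qed.

Lemma dist_black0 c i : c i -> dist_black c i = 0.
Proof. by move=> ci; apply: dist_blackE. Qed.

Lemma dist_blackS c i : [exists j, c j] -> ~~ c i ->
  dist_black c i = (dist_black c (ordS i)).+1.
Proof.
move=> ex nci; apply: dist_blackE => [|[|k] // lt].
  by rewrite shiftSr dist_black_hit.
by rewrite shiftSr dist_black_min.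
Qed.

(* The value 0 at a white bead makes next_black the one-ball siteswap itself. *)
Definition next_black c i := if c i then (dist_black c (ordS i)).+1 else 0.

Lemma next_black_gt0 c i : (0 < next_black c i) = c i.
Proof. by rewrite /next_black; case: (c i). Qed.

Lemma next_black_hit c i : [exists j, c j] -> c (shift (next_black c i) i) = c i.
Proof.
rewrite /next_black => ex; case ci: (c i); last by rewrite /= ci.
by rewrite shiftSr dist_black_hit.
Qed.


Lemma next_black_min c i k : 0 < k < next_black c i -> ~~ c (shift k i).
Proof.
rewrite /next_black; case: k => // k; case: (c i) => // lt.
by rewrite shiftSr dist_black_min.
Qed.

(** For k <= l, shifting both sides back by k puts i at distance l - k from j. Unless l = k, the
    black bead i would lie strictly between j and the black bead following j. *)
Lemma next_black_cover c i j k l : k < next_black c i -> l < next_black c j ->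
  shift k i = shift l j -> i = j /\ k = l.
Proof.
wlog le_kl : i j k l / k <= l => [wl ki lj E|ki lj].
  case/orP: (leq_total k l) => le; first exact: wl.
  by have [] := wl j i l k le lj ki (esym E).
rewrite -{1}(subnKC le_kl) shiftD => /shift_inj Ei.
have ci : c i by rewrite -next_black_gt0; apply: leq_ltn_trans ki.
have [E|gt] := posnP (l - k).
  by rewrite Ei E; split=> //; apply/eqP; rewrite eqn_leq le_kl -subn_eq0 E.
have := @next_black_min c j (l - k); rewrite gt (leq_ltn_trans (leq_subr _ _) lj).
by move/(_ isT); rewrite -Ei ci.
Qed.

(** White beads stay fixed and black beads go to black ones; two black beads with the same target
    share the last beat of their arcs. *)
Lemma next_black_inj c : [exists j, c j] ->
  injective (fun i => shift (next_black c i) i).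
Proof.
move=> ex i j /= E.
have cij : c i = c j by rewrite -(next_black_hit i ex) E next_black_hit.
case ci: (c i); last by move: E; rewrite /next_black -cij ci.
have ui : 0 < next_black c i by rewrite next_black_gt0.
have uj : 0 < next_black c j by rewrite next_black_gt0 -cij.
move: E; rewrite -(prednK ui) -(prednK uj) => /ordS_inj E.
by have [] := @next_black_cover c i j _ _ _ _ E; rewrite ?prednK.
Qed.

Lemma next_black_one_ball c : [exists j, c j] -> one_ball (next_black c).
Proof.
move=> ex; split; first exact: next_black_inj.
have [x cx] := existsP ex.
(* It suffices that one beat is covered exactly once: disjointness of the arcs gives at most once,
   and a black [x] starts an arc over itself. *)
rewrite (sum_covers_const x (next_black_inj ex)) -[RHS]muln1; congr (_ * _).
apply/eqP; rewrite eqn_leq; apply/andP; split.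
  by apply/covers_le1P => i j k l ki lj <- E; apply: next_black_cover ki lj _.
apply/card_gt0P; have ux : 0 < next_black c x by rewrite next_black_gt0.
by exists (Tagged (fun i => 'I_(next_black c i)) (Ordinal ux)); rewrite inE /=.
Qed.

(** An arc must end where another begins: if u vanished at the landing beat, that beat and i would
    land together, forcing u_i = 0. No arc begins strictly inside another, since beats are covered
    once. *)
Lemma one_ballE u i : one_ball u -> u i = next_black (fun j => 0 < u j) i.
Proof.
move=> ob; rewrite /next_black; case: posnP => // ui.
rewrite -(prednK ui); congr _.+1; apply/esym/dist_blackE => [|k lt].
  rewrite -shiftSr prednK // lt0n; apply/eqP => u0.
  have : shift (u i) i = i by apply: (proj1 ob); rewrite u0.
  by move=> E; rewrite E in u0; rewrite u0 in ui.
rewrite -shiftSr -eqn0Ngt -leqn0 leqNgt; apply/negP => uk.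
have lt' : k.+1 < u i by rewrite -(prednK ui).
by have [] := one_ball_cover ob lt' uk (erefl : _ = shift 0 _).
Qed.

Lemma one_ball_exists u : 0 < n -> one_ball u -> [exists i, 0 < u i].
Proof.
move=> n0 [_ sumu]; apply: contraLR n0; rewrite negb_exists => /forallP u0.
rewrite -eqn0Ngt -sumu sum_nat_eq0; apply/forallP => i; apply/implyP => _.
by have := u0 i; rewrite -eqn0Ngt.
Qed.

(** * Even gaps and distinct midpoints *)

Lemma even_gapsP (c : {ffun 'I_n -> bool}) : [exists i, c i] ->
  reflect (forall i, c i -> odd (next_black c i)) (even_gaps c).
Proof.
move=> ex; apply: (iffP forallP) => [ev i ci|od i].
  have lt := dist_black_lt (ordS i) ex.
  have /forallP/(_ (Ordinal lt)) := ev i; rewrite /next_black ci /=.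
  move/implyP; apply; apply/and3P; split => //.
    by apply/forallP=> j; rewrite iterSr; apply: dist_black_min (ltn_ord j).
  by rewrite -/(shift _.+1 i) shiftSr dist_black_hit.
apply/forallP => k; apply/implyP => /and3P[ci /forallP wh ck].
have := od i ci; rewrite /next_black ci /= (@dist_blackE _ _ k) //.
  by rewrite -shiftSr.
by move=> l lt; have := wh (Ordinal lt); rewrite -shiftSr.
Qed.

(** The congruence compares the midpoints i + u_i / 2 modulo n, doubled to stay in the integers.
    White beads, where u_i = 0, take part as well. *)
Lemma even_gaps_half_inj (c : {ffun 'I_n -> bool}) : [exists i, c i] ->
  even_gaps c <->
  (forall i j, 2 * i + next_black c i = 2 * j + next_black c j %[mod 2 * n] -> i = j).
Proof.
move=> ex; have ob := next_black_one_ball ex.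
split=> [/(even_gapsP ex) od i j E|inj].
  (* The modulus 2n is even, so parity separates black beads from white ones. *)
  have /(congr1 odd) : (2 * i + next_black c i) %% 2 = (2 * j + next_black c j) %% 2.
    by rewrite -(modn_dvdm _ (dvdn_mulr n (dvdnn 2))) E modn_dvdm ?dvdn_mulr.
  have oddu l : odd (next_black c l) = c l.
    by case cl: (c l); [exact: od | rewrite /next_black cl].
  rewrite !modn2 !oddb ![odd (2 * _ + _)]oddD !oddM !oddu /= => cij.
  case ci: (c i); last first.
    move/eqP: E; rewrite /next_black -cij ci !addn0 -!muln_modr eqn_mul2l /=.
    by rewrite !modn_small // => /eqP/val_inj.
  have half l : c l -> next_black c l = 2 * (next_black c l)./2 + 1.
    by move=> cl; rewrite -{1}[LHS]odd_double_half od // addnC mul2n.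
  have split_half l : c l ->
      2 * l + next_black c l = 2 * (l + (next_black c l)./2) + 1.
    by move=> /half; lia.
  (* Removing the common 1 and halving leaves the beats i + (u_i - 1) / 2, each inside its own arc;
     disjointness of the arcs gives i = j. *)
  move/eqP: E; rewrite !split_half -?cij // eqn_modDr -!muln_modr eqn_mul2l /=.
  move=> /eqP/shift_eq E.
  have hi := half i ci; have hj := half j (etrans (esym cij) ci).
  by apply: (proj1 (@next_black_cover c _ _ _ _ _ _ E)); lia.
apply/(even_gapsP ex) => i ci; apply/negPn/negP => ev.
have ui : 0 < next_black c i by rewrite next_black_gt0.
have hi : next_black c i = 2 * (next_black c i)./2.
  by rewrite -{1}(odd_double_half (next_black c i)) (negPf ev) mul2n.
(* The midpoint of an even arc is a white bead j with u_j = 0, so i and j have the same midpoint. *)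
set j := shift (next_black c i)./2 i.
have ncj : ~~ c j by apply: next_black_min; lia.
have ij : i = j.
  apply: inj; rewrite {2}/next_black (negPf ncj) addn0 /j val_shift.
  by rewrite muln_modr modn_mod mulnDr -hi.
by rewrite -ij ci in ncj.
Qed.

End Cyclic.

(** * Counting closed walks in a finite graph *)

Section ClosedWalks.
Variables (T : finType) (e : rel T).

(** The index k counts interior vertices, so these walks have k + 1 edges: the entry (x, y) of the
    (k + 1)-st power of the adjacency matrix. *)
Fixpoint walks k x y : nat :=
  if k is k'.+1 then \sum_z e x z * walks k' z y else e x y.

Definition closed_walks n : {set {ffun 'I_n -> T}} :=
  [set s : {ffun 'I_n -> T} | [forall i, e (s i) (s (ordS i))]].

Lemma card_tuple_cons k (P : pred (k.+1.-tuple T)) :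
  #|[set t | P t]| = \sum_x #|[set p : k.-tuple T | P [tuple of x :: p]]|.
Proof.
rewrite -sum1dep_card (partition_big (@thead _ T) predT) //=.
apply: eq_bigr => x _; rewrite -sum1dep_card.
rewrite (reindex_onto (fun p : k.-tuple T => [tuple of x :: p])
  (fun t => [tuple of behead t])) /= => [|t /andP[_ /eqP <-]].
  apply: eq_bigl => p; rewrite theadE eqxx andbT.
  by rewrite [X in _ && X](_ : _ = true) ?andbT //; apply/eqP/val_inj.
by rewrite [t in RHS]tuple_eta.
Qed.

Lemma card_walks k x y :
  #|[set p : k.-tuple T | path e x (rcons p y)]| = walks k x y.
Proof.
elim: k x => [|k IHk] x /=.
  rewrite (eq_finset (fun=> e x y)) => [|p]; last by rewrite (tuple0 p) /= andbT.
  by case: (e x y); [rewrite cardsT card_tuple|rewrite cards0].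
rewrite (card_tuple_cons (fun t => path e x (rcons t y))).
apply: eq_bigr => z _; rewrite -IHk.
case exz: (e x z); rewrite ?mul1n ?mul0n.
  by apply: eq_card => p; rewrite !inE /= exz.
by apply: eq_card0 => p; rewrite inE /= exz.
Qed.

Lemma cycle_tnth m (t : m.+1.-tuple T) :
  cycle e t = [forall i, e (tnth t i) (tnth t (ordS i))].
Proof.
case/tupleP: t => x p; have szp : size p = m by rewrite size_tuple.
have ith (i : 'I_m.+1) : tnth [tuple of x :: p] i = nth x (x :: rcons p x) i.
  by rewrite (tnth_nth x) /= -rcons_cons nth_rcons_default.
have Sith (i : 'I_m.+1) : tnth [tuple of x :: p] (ordS i) = nth x (rcons p x) i.
  rewrite (tnth_nth x) /= nth_rcons_default.
  (* At the last index the successor wraps around to the head [x], which is also the default value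
     of [nth]. *)
  have := ltn_ord i; rewrite ltnS leq_eqVlt => /predU1P[->|im].
    by rewrite modnn [RHS]nth_default ?szp.
  by rewrite modn_small.
apply/(pathP x)/forallP => [w i|w i].
  by rewrite ith Sith w // size_rcons szp.
rewrite size_rcons szp => im.
by have := w (Ordinal im); rewrite ith Sith.
Qed.

Lemma card_closed_walks m : #|closed_walks m.+1| = \sum_x walks m x x.
Proof.
rewrite -sum1dep_card (reindex (fun t : m.+1.-tuple T => [ffun i => tnth t i])).
  rewrite (eq_bigl (fun t : m.+1.-tuple T => cycle e t)) => [|t]; last first.
    by rewrite cycle_tnth; apply: eq_forallb => i; rewrite !ffunE.
  rewrite sum1dep_card card_tuple_cons.
  by apply: eq_bigr => x _; rewrite -card_walks.
exists (fun s : {ffun 'I_m.+1 -> T} => [tuple s i | i < m.+1]) => [t|s] _.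
  by apply: eq_from_tnth => i; rewrite tnth_mktuple ffunE.
by apply/ffunP => i; rewrite ffunE tnth_mktuple.
Qed.

End ClosedWalks.

(** * Necklaces as non-alternating walks on the golden-mean graph *)

Definition not_both (x y : bool) := ~~ (x && y).
Definition differ (x y : bool) := x != y.

Lemma differ_not_both n : closed_walks differ n \subset closed_walks not_both n.
Proof.
apply/fintype.subsetP => s; rewrite !inE => /forallP d; apply/forallP => i.
by have := d i; rewrite /differ /not_both; do 2!case: (s _).
Qed.

Lemma card_necklaces n : a2 n + #|closed_walks differ n| = #|closed_walks not_both n|.
Proof.
pose N := [set c : {ffun 'I_n -> bool} | [exists i, c i] && even_gaps c].
pose par (c : {ffun 'I_n -> bool}) := [ffun i => odd (dist_black c i)].
(* The colouring is recovered from the parities: a bead is black exactly when it and its successor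
   are both even. Across a white bead the parity flips. *)
have black_par c : c \in N -> forall i,
    c i = ~~ par c i && ~~ par c (ordS i).
  rewrite inE => /andP[ex /(even_gapsP ex) od] i; rewrite !ffunE.
  case ci: (c i); last by rewrite (dist_blackS ex) ?ci //=; case: odd.
  by have := od i ci; rewrite /next_black ci (dist_black0 ci) /=; case: odd.
have white_par c : c \in N -> forall i,
    ~~ c i -> par c i = ~~ par c (ordS i).
  rewrite inE => /andP[ex _] i nci.
  by rewrite !ffunE (dist_blackS ex nci) oddS.
have parN : par @: N = closed_walks not_both n :\: closed_walks differ n.
  apply/setP => s; apply/imsetP/idP => [[c cN ->]|].
    rewrite !inE negb_forall; apply/andP; split.
      have /andP[/existsP[i ci] _] : [exists i, c i] && even_gaps c by rewrite inE in cN.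
      apply/existsP; exists i; move: ci; rewrite (black_par c cN) /differ.
      by do 2!case: (par c _).
    apply/forallP => i; rewrite /not_both.
    have := black_par c cN i; have := white_par c cN i.
    by case: (c i) => [_|/(_ isT) ->]; do 2?case: (par c _).
  rewrite !inE => /andP[/forallPn[i0 di0] /forallP nb].
  (* The inverse map. A non-alternating walk has two equal adjacent states; they cannot both be odd,
     so they are even and give a black bead. *)
  pose c := [ffun i => ~~ s i && ~~ s (ordS i)].
  have ex : [exists i, c i].
    apply/existsP; exists i0; rewrite ffunE; move: di0 (nb i0).
    by rewrite /differ /not_both; do 2!case: (s _).
  have sE i : s i = odd (dist_black c i).
    (* Induction on the distance to the next black bead: the state there is even, and states
       alternate along the white beads before it. *)
    move d: (dist_black c i) => k; elim: k i d => [|k IHk] i d.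
      have := dist_black_hit i ex; rewrite d /= ffunE => /andP[/negPf-> _] //.
    have nci : ~~ c i by apply/negP => /dist_black0; rewrite d.
    have := d; rewrite (dist_blackS ex nci) => -[/IHk] /=.
    move: (nb i) nci; rewrite /not_both ffunE.
    by do 2!case: (s _) => //=; case: odd.
  exists c; last by apply/ffunP => i; rewrite ffunE.
  rewrite inE ex; apply/(even_gapsP ex) => i ci.
  rewrite /next_black ci /= -sE.
  by move: ci; rewrite ffunE => /andP[].
have inj_par : {in N &, injective par}.
  by move=> c c' cN c'N E; apply/ffunP => i; rewrite (black_par _ cN) (black_par _ c'N) E.
rewrite /a2 -/N -(card_in_imset inj_par) parN cardsDS ?differ_not_both //.
by rewrite subnK // subset_leq_card // differ_not_both.
Qed.

(** * The recurrence for [a2] *)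

(** The adjacency matrix A of the golden-mean graph satisfies A^2 = A + 1. *)
Lemma walks_not_both k x y :
  walks not_both k.+2 x y = walks not_both k.+1 x y + walks not_both k x y.
Proof.
have S k' : (walks not_both k'.+1 true y = walks not_both k' false y) *
    (walks not_both k'.+1 false y =
       walks not_both k' true y + walks not_both k' false y).
  by rewrite /= !big_bool /not_both /= !mul1n !mul0n; split; lia.
by case: x; rewrite !S; lia.
Qed.

Lemma walks_differ k x y : walks differ k x y = odd k (+) x (+) y.
Proof.
elim: k x => [|k IHk] x /=; first by case: x; case: y.
by rewrite big_bool /= !IHk; case: x; case: (y); case: odd.
Qed.

Lemma card_not_both_rec m : #|closed_walks not_both m.+3| =
  #|closed_walks not_both m.+2| + #|closed_walks not_both m.+1|.
Proof.
rewrite !card_closed_walks -big_split.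
by apply: eq_bigr => x _; apply: walks_not_both.
Qed.

Lemma card_differ m : #|closed_walks differ m.+1| = 2 * odd m.
Proof. by rewrite card_closed_walks big_bool !walks_differ; case: odd. Qed.

Lemma a2_0 : a2 0 = 0.
Proof.
apply/eqP; rewrite cards_eq0; apply/eqP/setP => c; rewrite !inE.
by case: existsP => // -[[]].
Qed.

Lemma a2_1 : a2 1 = 1.
Proof.
have := card_necklaces 1; rewrite card_differ card_closed_walks big_bool /=.
by rewrite /not_both /=; lia.
Qed.

Lemma a2_2 : a2 2 = 1.
Proof.
have := card_necklaces 2; rewrite card_differ card_closed_walks big_bool /=.
by rewrite !big_bool /not_both /=; lia.
Qed.

(** Let D(n) count the alternating walks. The correction to the Fibonacci recurrence is D(m+1) +
    D(m) - D(m+2) = D(m+1), as D has period 2. The walk recurrence starts at length 1, so m = 0 is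
    checked directly. *)
Lemma a2_rec m : a2 m.+2 = a2 m.+1 + a2 m + 2 * odd m.
Proof.
case: m => [|m]; first by rewrite a2_2 a2_1 a2_0.
have := card_not_both_rec m; rewrite -!card_necklaces !card_differ /=.
by case: odd; lia.
Qed.

Import GRing.Theory Num.Theory.
Local Open Scope ring_scope.

Lemma a2_recZ m :
  (a2 m.+2)%:Z = (a2 m.+1)%:Z + (a2 m)%:Z + 1 - (-1) ^+ m.+2.
Proof.
rewrite a2_rec -signr_odd /= negbK.
by case: odd; rewrite /= ?expr0 ?expr1; lia.
Qed.

Lemma a2_assoc_mersenne n : (a2 n)%:Z = assoc_mersenne n.
Proof.
suff [] : (a2 n)%:Z = assoc_mersenne n /\ (a2 n.+1)%:Z = assoc_mersenne n.+1 by [].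
elim: n => [|m [IH0 IH1]]; first by rewrite a2_0 a2_1.
by split=> //; rewrite a2_recZ IH0 IH1.
Qed.

(** * From siteswaps to necklaces and the final count *)

Lemma eq_ratmod_half n (i j a b : nat) :
  eq_ratmod n (i%:R + a%:R / 2%:R) (j%:R + b%:R / 2%:R) <->
  (2 * i + a = 2 * j + b %[mod 2 * n])%N.
Proof.
suff E k : (2 * i + a)%N%:Z - (2 * j + b)%N%:Z = k * (2 * n)%N%:Z <->
    i%:R + a%:R / 2%:R - (j%:R + b%:R / 2%:R) = k%:~R * n%:R :> rat.
  split=> [[k /E eq_k]|/eqP].
    by apply/eqP; rewrite -eqz_nat -!modz_nat eqz_mod_dvd; apply/dvdzP; exists k.
  by rewrite -eqz_nat -!modz_nat eqz_mod_dvd => /dvdzP[k /E eq_k]; exists k.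
(* Clearing the denominator 2 turns the rational equation into the image of the integer one. *)
suff -> : ((2 * i + a)%N%:Z - (2 * j + b)%N%:Z = k * (2 * n)%N%:Z) <->
    2%:R * i%:R + a%:R - (2%:R * j%:R + b%:R) = k%:~R * (2%:R * n%:R) :> rat.
  by split=> ?; lra.
rewrite -!natrM -!natrD !pmulrn -intrB -intrM.
by split=> [->|/intr_inj].
Qed.

Lemma num_balls2 n (u : 'I_n -> nat) : (0 < n)%N ->
  num_balls [ffun i => (u i).+1] = 2%:R <-> (\sum_i u i = n)%N.
Proof.
move=> n0; rewrite /num_balls.
have -> : (\sum_(i < n) [ffun i => (u i).+1] i = \sum_i u i + n)%N.
  transitivity (\sum_(i < n) (u i + 1))%N.
    by apply: eq_bigr => i _; rewrite ffunE addn1.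
  by rewrite big_split sum1_card card_ord.
have nz : n%:R != 0 :> rat by rewrite pnatr_eq0 -lt0n.
split=> [/(canRL (divfK nz))|->].
  by rewrite -natrM => /eqP; rewrite eqr_nat => /eqP; lia.
by rewrite addnn -mul2n natrM mulfK.
Qed.

Definition necklace_siteswap n (c : {ffun 'I_n -> bool}) : {ffun 'I_n -> nat} :=
  [ffun i => (next_black c i).+1].

Lemma necklace_siteswap_inj n : injective (@necklace_siteswap n).
Proof.
move=> c c' E; apply/ffunP => i; rewrite -!next_black_gt0.
by have := congr1 (fun t : {ffun _} => t i) E; rewrite !ffunE => -[->].
Qed.

(** Adding 1 to every throw delays all landings by one beat, which keeps them distinct. *)
Lemma siteswapP n (u : 'I_n -> nat) :
  siteswap [ffun i => (u i).+1] <-> injective (fun i => shift (u i) i).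
Proof.
split=> inj i j => [E|]; last first.
  by rewrite !ffunE => /shift_eq; rewrite !shiftS => /ordS_inj/inj.
by apply: inj; rewrite !ffunE; apply/shift_eq; rewrite !shiftS E.
Qed.

Lemma two_ball_sphericalP n (t : {ffun 'I_n -> nat}) : (0 < n)%N ->
  [/\ spherical_siteswap t, num_balls t = 2%:R & forall i, (1 <= t i)%N] <->
  exists2 c : {ffun 'I_n -> bool}, [exists i, c i] && even_gaps c & t = necklace_siteswap c.
Proof.
move=> n0.
(* All throws u_i + 1 are nonzero, so every pair of positions is compared; the extra 1 cancels from
   both doubled midpoints. *)
have spherical_inj (u : 'I_n -> nat) :
    (forall i j : 'I_n, [ffun i => (u i).+1] i <> 0%N ->
      [ffun i => (u i).+1] j <> 0%N ->
      eq_ratmod n (i%:R + ([ffun i => (u i).+1] i)%:R / 2%:R)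
                  (j%:R + ([ffun i => (u i).+1] j)%:R / 2%:R) -> i = j) <->
    (forall i j : 'I_n, (2 * i + u i = 2 * j + u j %[mod 2 * n])%N -> i = j).
  split=> inj i j => [E|_ _]; last first.
    by move=> /eq_ratmod_half; rewrite !ffunE !addnS => /eqP;
       rewrite -!(addn1 (_ + _)%N) eqn_modDr => /eqP/inj.
  apply: inj; rewrite ?ffunE //; apply/eq_ratmod_half.
  by rewrite !addnS; apply/eqP; rewrite -!(addn1 (_ + _)%N) eqn_modDr; apply/eqP.
split=> [[[ss sph] nb t1]|[c /andP[ex ev] ->]].
  pose u i := (t i).-1.
  have tE : t = [ffun i => (u i).+1].
    by apply/ffunP => i; rewrite ffunE /u prednK.
  move: ss sph nb; rewrite tE => /siteswapP inju /spherical_inj half_inj.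
  move=> /(num_balls2 _ n0) sumu; have ob : one_ball u by [].
  pose c := [ffun i => (0 < u i)%N]; have ex := one_ball_exists n0 ob.
  have uE i : u i = next_black c i.
    rewrite one_ballE // /next_black /dist_black ffunE.
    by under [in RHS]eq_find => k do rewrite ffunE.
  have exc : [exists i, c i].
    by have /existsP[i ui] := ex; apply/existsP; exists i; rewrite ffunE.
  exists c; last by apply/ffunP => i; rewrite !ffunE uE.
  rewrite exc; apply/(even_gaps_half_inj exc) => i j.
  by rewrite -!uE; apply: half_inj.
have [inju sumu] := next_black_one_ball ex.
split; [split | exact/(num_balls2 _ n0) | by move=> i; rewrite ffunE].
  exact/siteswapP.
by apply/spherical_inj; apply/even_gaps_half_inj.
Qed.

Theorem mainTheorem5 :
  (forall n : nat, (1 <= n)%N ->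
     ([set t : {ffun 'I_n -> nat} |
        [/\ spherical_siteswap t, num_balls t = 2%:R
          & forall i : 'I_n, (1 <= t i)%N]]%classic #= `I_(a2 n))%card)
  /\ a2 0 = 0%N
  /\ a2 1 = 1%N
  /\ (forall n : nat, (2 <= n)%N ->
        (a2 n)%:Z = (a2 (n - 1))%:Z + (a2 (n - 2))%:Z + 1 - (-1) ^+ n)
  /\ (forall n : nat, (a2 n)%:Z = assoc_mersenne n).
Proof.
split; last first.
  split; first exact: a2_0.
  split; first exact: a2_1.
  split; last exact: a2_assoc_mersenne.
  by case=> [|[|m]] // _; rewrite a2_recZ subn1 subn2.
move=> n n0; rewrite /a2.
set N := [set c : {ffun 'I_n -> bool} | _].
(* The set of siteswaps is the image, under an injective map, of an enumeration of the necklaces. *)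
rewrite (_ : mkset _ =
    ((fun k : 'I_#|N| => necklace_siteswap (enum_val k)) @` setT)%classic).
  apply: card_eq_trans (inj_card_eq _) (card_esym card_II) => k l _ _.
  by move=> /necklace_siteswap_inj/enum_val_inj.
apply/seteqP; split=> t /=.
  move=> /(two_ball_sphericalP _ n0)[c cN ->].
  have {}cN : c \in N by rewrite inE.
  by exists (enum_rank_in cN c) => //; rewrite enum_rankK_in.
case=> k _ <-; apply/(two_ball_sphericalP _ n0); exists (enum_val k) => //.
by have := enum_valP k; rewrite inE.
Qed.
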